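(* Let $S$ be an automaton monoid and $T$ a finite monoid. Then the wreath product $S\wr T$ is an automaton monoid.
   Context: An automaton is a triple $\mathcal{A}=(Q,B,\delta)$ where $Q$ is a finite set of states, $B$ is a finite alphabet of symbols, and $\delta$ is a transformation of $Q\times B$ (a map $Q\times B\to Q\times B$). Each state $q\in Q$ acts on the right on the set $B^*$ of finite words over $B$: for $\alpha=\alpha_1\alpha_2\cdots\alpha_n\in B^*$, $\alpha\cdot q=\beta_1\beta_2\cdots\beta_n$ where $q_0=q$ and $(q_{i-1},\alpha_i)\delta=(q_i,\beta_i)$ for $i=1,\dots,n$. A non-empty word $w=w_1\cdots w_m\in Q^+$ acts by $\alpha\cdot w=(\cdots((\alpha\cdot w_1)\cdot w_2)\cdots)\cdot w_m$. Regarding $B^*$ as a rooted tree (the children of $\alpha$ are the words $\alpha b$, $b\in B$), this gives a homomorphism $\phi:Q^+\to\operatorname{End}B^*$ to the endomorphism semigroup of the tree (maps written on the right); its image is denoted $\Sigma(\mathcal{A})$. A semigroup $S$ is an automaton semigroup if there is an automaton $\mathcal{A}$ with $S\simeq\Sigma(\mathcal{A})$. An automaton monoid is an automaton semigroup that is a monoid. For monoids $S$ and $T$ with $T=\{t_1,\dots,t_n\}$ finite, the wreath product $S\wr T$ is the semidirect product $S^{|T|}\rtimes T$, where $T$ acts on $S^{|T|}$ (tuples indexed by $T$, with componentwise multiplication) by $(s_{t_1},s_{t_2},\dots,s_{t_n})^t=(s_{t_1t},s_{t_2t},\dots,s_{t_nt})$; that is, the multiplication is $(s,t)(s',t')=(s\,(s')^{t},\,tt')$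 for $s,s'\in S^{|T|}$, $t,t'\in T$. *)

(* Defs.v *)
From HB Require Import structures.
From mathcomp Require Import all_boot.
From mathcomp Require Import boolp.

Set Implicit Arguments.
Unset Strict Implicit.
Unset Printing Implicit Defensive.

Local Open Scope group_scope.

#[short(type="finMonoidType")]
HB.structure Definition FinMonoid := {T of Monoid T & Finite T}.

(* Endomorphisms of the rooted tree B^*: the children of a word a are the     *)
(* words rcons a b.                                                           *)
Definition tree_endomorphism (B : finType) (f : seq B -> seq B) : Prop :=
  f [::] = [::] /\ forall a b, exists b', f (rcons a b) = rcons (f a) b'.

Record tree_endo (B : finType) := TreeEndo {
  endo_fun :> seq B -> seq B;
  endoP : `[< tree_endomorphism endo_fun >]
}.

HB.instance Definition _ (B : finType) :=
  [isSub for @endo_fun B].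
HB.instance Definition _ (B : finType) :=
  [Choice of tree_endo B by <:].

Section TreeEndoSemigroup.
Variable B : finType.
Implicit Types f g h : tree_endo B.

Fact tree_endo_mul_proof f g : `[< tree_endomorphism (g \o f) >].
Proof.
have /asboolP[f0 fS] := endoP f; have /asboolP[g0 gS] := endoP g.
apply/asboolP; split=> [|a b] /=; first by rewrite f0 g0.
by have [b' ->] := fS a b; apply: gS.
Qed.

(* Maps act on the right: f * g is "first f, then g". *)
Definition tree_endo_mul f g : tree_endo B := TreeEndo (tree_endo_mul_proof f g).

Fact tree_endo_mulA : associative tree_endo_mul.
Proof. by move=> f g h; apply: val_inj. Qed.

HB.instance Definition _ := isSemigroup.Build (tree_endo B) tree_endo_mulA.

End TreeEndoSemigroup.

Record automaton := Automaton {
  state : finType;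
  alphabet : finType;
  transition : state * alphabet -> state * alphabet
}.

Section AutomatonSemigroup.
Variable A : automaton.
Local Notation Q := (state A).
Local Notation B := (alphabet A).

Fixpoint state_act (q : Q) (a : seq B) : seq B :=
  if a is a1 :: a' then
    let: (q', b1) := transition (q, a1) in b1 :: state_act q' a'
  else [::].

Fixpoint word_act (w : seq Q) (a : seq B) : seq B :=
  if w is q :: w' then word_act w' (state_act q a) else a.

Lemma word_act_cat w1 w2 a : word_act (w1 ++ w2) a = word_act w2 (word_act w1 a).
Proof. by elim: w1 a => //= q w1 IHw a. Qed.

Fact state_act_endo q : tree_endomorphism (state_act q).
Proof.
split=> // a; elim: a q => [|a1 a IHa] q b /=.
  by case: (transition _) => q' b'; exists b'.
by case: (transition _) => q' b1; have [b' ->] := IHa q' b; exists b'.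
Qed.

Fact word_act_endo w : `[< tree_endomorphism (word_act w) >].
Proof.
apply/asboolP; elim: w => [|q w [IH0 IHS]]; first by split=> // a b; exists b.
split=> //= a b; have [_ /(_ a b)[b' ->]] := state_act_endo q.
exact: IHS.
Qed.

Definition word_endo (w : seq Q) : tree_endo B := TreeEndo (word_act_endo w).

Lemma word_endo_cat w1 w2 : word_endo (w1 ++ w2) = word_endo w1 * word_endo w2.
Proof. by apply: val_inj; apply/funext => a; apply: word_act_cat. Qed.

Definition in_Sigma : pred (tree_endo B) :=
  fun f => `[< exists2 w : seq Q, w != [::] & f = word_endo w >].

Record Sigma := InSigma {
  Sigma_val :> tree_endo B;
  SigmaP : in_Sigma Sigma_val
}.

HB.instance Definition _ := [isSub for Sigma_val].
HB.instance Definition _ := [Choice of Sigma by <:].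

Fact in_Sigma_mulg_closed : mulg_closed in_Sigma.
Proof.
move=> _ _ /asboolP[w1 w1n ->] /asboolP[w2 w2n ->]; apply/asboolP.
by exists (w1 ++ w2); [case: w1 w1n | rewrite word_endo_cat].
Qed.

HB.instance Definition _ :=
  SubChoice_isSubSemigroup.Build _ in_Sigma Sigma in_Sigma_mulg_closed.

End AutomatonSemigroup.

Definition automaton_semigroup (S : semigroupType) : Prop :=
  exists (A : automaton) (f : S -> Sigma A),
    {morph f : x y / x * y} /\ bijective f.

(* The isomorphism with Sigma A is one of semigroups: the identity of the     *)
(* monoid need not act as the identity on words.                              *)
Definition automaton_monoid (S : monoidType) : Prop := automaton_semigroup S.

Definition wreath (S : monoidType) (T : finMonoidType) : Type :=
  ({ffun T -> S} * T)%type.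

Section Wreath.
Variables (S : monoidType) (T : finMonoidType).

Definition wreath_act (s : {ffun T -> S}) (t : T) : {ffun T -> S} :=
  [ffun x => s (x * t)].

Definition wreath_mul (u v : wreath S T) : wreath S T :=
  (u.1 * wreath_act v.1 u.2, u.2 * v.2).

Definition wreath_one : wreath S T := (1, 1).

Fact wreath_mulA : associative wreath_mul.
Proof.
move=> [s1 t1] [s2 t2] [s3 t3]; rewrite /wreath_mul /= mulgA; congr pair.
by apply/ffunP=> x; rewrite !ffunE !mulgA.
Qed.

Fact wreath_mul1g : left_id wreath_one wreath_mul.
Proof.
move=> [s t]; rewrite /wreath_mul /= !mul1g; congr pair.
by apply/ffunP=> x; rewrite !ffunE mulg1.
Qed.

Fact wreath_mulg1 : right_id wreath_one wreath_mul.
Proof.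
move=> [s t]; rewrite /wreath_mul /= mulg1; congr pair.
by apply/ffunP=> x; rewrite !ffunE mulg1.
Qed.

HB.instance Definition _ := Choice.on (wreath S T).
HB.instance Definition _ :=
  isMonoid.Build (wreath S T) wreath_mulA wreath_mul1g wreath_mulg1.

End Wreath.

(* Main.v *)
Require Import Defs.
From mathcomp Require Import all_boot.
From mathcomp Require Import boolp.

(** Let the automaton A realize S, with states Q and alphabet B.  The wreath
    product acts on T x B^* by (x, a).(s, t) = (x t, a.s(x)): the T-coordinate
    selects the component of s that acts on the B-word, and is then translated
    by t.  Composing two such maps gives exactly the multiplication of the wreath
    product, and the action is faithful, because T acts faithfully on itself by
    right translation and S acts faithfully on B^*.

    To make this the action of an automaton, T x B^* is embedded in words over
    the alphabet T x B: a state (f, t), with f : T -> Q, translates every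
    T-coordinate by t and lets f x act on the word of B-coordinates, where x is
    the T-coordinate of the first letter.  After the first letter (x, b) this
    choice is made, so the next state is (const q', t), with q' the state that
    f x moves to on reading b.  Every state therefore stands for an element of
    the wreath product itself, so that no foreign elements enter the semigroup
    ([wreath_word_act], [wreath_realizes_faithful]).

    Two degenerate features of A have to be removed first.

    - A product of n states (f_j, t_j) has components that are all products of
      n states of A.  To reach an arbitrary (s, t), the words of Q^+ that give
      the components s(x) must be brought to a common length, so some state
      must represent the identity of S ([wreath_generated]).  The identity is
      represented by some word of length k.+1, and the automaton whose states
      are the words of length at most k.+1 in Q^+ has this word as a state and
      generates the same semigroup ([realizes_with_identity]).
    - If B is empty, then T x B is empty too and the action of T cannot be seen;
      but then S is trivial, hence realized over a one-letter alphabet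
      ([realizes_nonempty_alphabet]).

    Isomorphisms with the semigroup of an automaton are handled through the
    equivalent notion [realizes]: an assignment of monoid elements to states
    that generates the monoid and under which two non-empty words act equally
    exactly when their values agree. *)

Set Implicit Arguments.
Unset Strict Implicit.
Unset Printing Implicit Defensive.

Local Open Scope group_scope.

(** * Presentations of monoids by automata *)

Definition word_val (S : monoidType) (Q : Type) (g : Q -> S) (w : seq Q) : S :=
  \big[*%g/1]_(q <- w) g q.

(** This says that the words-to-values map induces an isomorphism between the
    automaton semigroup and S.  Only non-empty words are compared, because the
    identity of S need not act as the identity on words, whereas the empty
    word does. *)
Definition realizes (S : monoidType) (A : automaton) (g : state A -> S) : Prop :=
  (forall s, exists2 w, w != [::] & word_val g w = s) /\
  (forall v w, v != [::] -> w != [::] ->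
     word_act v =1 word_act w <-> word_val g v = word_val g w).

Lemma word_val_cons (S : monoidType) (Q : Type) (g : Q -> S) q w :
  word_val g (q :: w) = g q * word_val g w.
Proof. by rewrite /word_val big_cons. Qed.

Lemma word_val_cat (S : monoidType) (Q : Type) (g : Q -> S) v w :
  word_val g (v ++ w) = word_val g v * word_val g w.
Proof. by rewrite /word_val big_cat. Qed.

Lemma word_act_nil (A : automaton) (w : seq (state A)) : word_act w [::] = [::].
Proof. by elim: w. Qed.

Lemma word_endo_eq (A : automaton) (v w : seq (state A)) :
  word_endo v = word_endo w <-> word_act v =1 word_act w.
Proof.
split=> [E a|E]; first by rewrite -[word_act v]/(endo_fun (word_endo v)) E.
by apply: val_inj; apply/funext.
Qed.

(** The isomorphism sends s to the action of a chosen word of value s; by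
    faithfulness the choice is immaterial, which makes it multiplicative. *)
Lemma realizes_automaton_semigroup (S : monoidType) (A : automaton)
    (g : state A -> S) : realizes g -> automaton_semigroup S.
Proof.
move=> [gen faith].
have /choice[rep repP] s : exists w, w != [::] /\ word_val g w = s.
  by have [w] := gen s; exists w.
have inS s : in_Sigma (word_endo (rep s)).
  by apply/asboolP; exists (rep s) => //; have [] := repP s.
have Ef s w : w != [::] -> word_val g w = s -> word_endo (rep s) = word_endo w.
  have [rep0 repS] := repP s.
  by move=> w0 wS; apply/word_endo_eq/faith; rewrite ?repS.
exists A, (fun s => InSigma (inS s)); split.
  move=> s t; apply: val_inj => /=; have [[s0 sS] [t0 tS]] := (repP s, repP t).
  rewrite -word_endo_cat; apply: Ef; first by case: (rep s) s0.
  by rewrite word_val_cat sS tS.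
have /choice[h hK] (x : Sigma A) : exists s, InSigma (inS s) = x.
  have /asboolP[w w0 Ex] := SigmaP x; exists (word_val g w).
  by apply: val_inj; rewrite /= Ex; apply: Ef.
exists h => // s; have /(congr1 val)/= := hK (InSigma (inS s)).
have [[s0 sS] [t0 tS]] := (repP (h (InSigma (inS s))), repP s).
by move/word_endo_eq/faith; rewrite sS tS; apply.
Qed.

(** Conversely, a state has as value the preimage of its own action, seen as
    a one-letter word. *)
Lemma automaton_semigroup_realizes (S : monoidType) :
  automaton_semigroup S -> exists (A : automaton) (g : state A -> S), realizes g.
Proof.
move=> [A [f [fM [h fK hK]]]].
have inS (q : state A) : in_Sigma (word_endo [:: q]).
  by apply/asboolP; exists [:: q].
pose g q := h (InSigma (inS q)); exists A, g.
have fg w : w != [::] -> Sigma_val (f (word_val g w)) = word_endo w.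
  elim: w => // q [_ _|p w IH _].
    by rewrite /word_val big_seq1 hK.
  by rewrite word_val_cons fM [RHS](word_endo_cat [:: q]) -IH //= /g hK.
split=> [s|v w v0 w0].
  have /asboolP[w w0 Ew] := SigmaP (f s); exists w => //.
  by apply: (can_inj fK); apply: val_inj; rewrite /= fg.
rewrite -word_endo_eq -!fg //; split=> [|-> //].
by move=> E; apply: (can_inj fK); apply: val_inj.
Qed.

(** * Removing an empty alphabet *)

(** Over an empty alphabet all words of states act equally, so faithfulness
    makes S trivial; the one-state, one-letter automaton then serves. *)
Lemma realizes_nonempty_alphabet (S : monoidType) (A : automaton)
    (g : state A -> S) : realizes g ->
  exists (A' : automaton) (g' : state A' -> S), realizes g' /\ inhabited (alphabet A').
Proof.
move=> [gen faith].
have [b|B0] := pickP [pred b : alphabet A | true]; first by exists A, g.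
have trivS (s t : S) : s = t.
  have [[v v0 <-] [w w0 <-]] := (gen s, gen t); apply/faith => // -[|b a].
    by rewrite !word_act_nil.
  by have := B0 b.
exists (@Automaton unit unit id), (fun=> 1); split; last exact: inhabits tt.
split=> [s|v w _ _]; first by exists [:: tt]; last exact: trivS.
have act_id (u : seq unit) : word_act (A := @Automaton unit unit id) u =1 id.
  have state_act_id q : state_act (A := @Automaton unit unit id) q =1 id.
    by elim=> //= -[] a ->.
  by elim: u => //= q u IHu a; rewrite state_act_id.
by split=> [_|_ a]; [apply: trivS | rewrite !act_id].
Qed.

(** * Making the identity a state *)

(** The transition of a word of states, regarded as a single state of an
    iterated automaton: the letter passes through the states from left to
    right, and the word of their successors is the new state. *)
Fixpoint word_step (A : automaton) (w : seq (state A)) (b : alphabet A) :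
    seq (state A) * alphabet A :=
  if w is q :: w' then
    let: (q', b1) := transition (q, b) in
    let: (w'', b2) := word_step w' b1 in (q' :: w'', b2)
  else ([::], b).

Lemma size_word_step (A : automaton) (w : seq (state A)) b :
  size (word_step w b).1 = size w.
Proof.
elim: w b => //= q w IHw b; case: (transition _) => q' b1.
by case: (word_step _ _) (IHw b1) => w'' b2 /= ->.
Qed.

Lemma word_act_cons (A : automaton) (w : seq (state A)) b a :
  word_act w (b :: a) = (word_step w b).2 :: word_act (word_step w b).1 a.
Proof.
elim: w b a => //= q w IHw b a; case: (transition _) => q' b1; rewrite IHw.
by case: (word_step _ _).
Qed.

(** The pair (q, u) encodes the non-empty word q :: u of length at most k.+1.
    The successors of u have the same length as u, so [insub_bseq] never falls
    back on its default value. *)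
Definition power_transition (A : automaton) (k : nat)
    (p : (state A * k.-bseq (state A)) * alphabet A) :
    (state A * k.-bseq (state A)) * alphabet A :=
  let: (q, u, b) := p in
  let: (q', b1) := transition (q, b) in
  (q', insub_bseq k (word_step u b1).1, (word_step u b1).2).

Definition power_automaton (A : automaton) (k : nat) : automaton :=
  Automaton (@power_transition A k).

Definition power_word (A : automaton) (k : nat)
    (p : state (power_automaton A k)) : seq (state A) :=
  p.1 :: bseqval p.2.

Lemma power_state_act (A : automaton) (k : nat)
    (p : state (power_automaton A k)) :
  state_act p =1 word_act (power_word p).
Proof.
move=> a; elim: a p => [|b a IHa] [q u].
  by elim: (power_word _) => //= ? ? <-.
rewrite word_act_cons /=; case: (transition _) => q' b1; rewrite IHa /power_word /=.
rewrite /insub_bseq insubdK; first by case: (word_step _ _).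
by rewrite unfold_in /= size_word_step size_bseq.
Qed.

Lemma power_word_act (A : automaton) (k : nat)
    (w : seq (state (power_automaton A k))) :
  word_act w =1 word_act (flatten (map (@power_word A k) w)).
Proof.
by elim: w => //= p w IHw a; rewrite IHw power_state_act word_act_cat.
Qed.

(** If q :: u has value 1, it is a state of the automaton with k = size u.  The
    words of length one are states as well, so generation is inherited; and a
    word over the new states acts as its flattening does, so faithfulness is
    inherited too. *)
Lemma realizes_with_identity (S : monoidType) (A : automaton)
    (g : state A -> S) : realizes g ->
  exists k (h : state (power_automaton A k) -> S), realizes h /\ exists i, h i = 1.
Proof.
move=> [gen faith]; have [[//|q u] _ Eu] := gen 1.
pose k := size u; exists k, (fun p => word_val g (power_word p)).
have valE (w : seq (state (power_automaton A k))) :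
    word_val (fun p => word_val g (power_word p)) w
    = word_val g (flatten (map (@power_word A k) w)).
  elim: w => [|p w IHw]; first by rewrite /word_val !big_nil.
  by rewrite word_val_cons IHw /= -word_val_cat.
split; last by exists (q, in_bseq u).
split=> [s|v w v0 w0].
  have [w w0 <-] := gen s; exists [seq (p, [bseq]) | p <- w]; first by case: w w0.
  rewrite valE -map_comp; congr word_val.
  by elim: w {w0} => //= p w ->.
rewrite !valE -faith; first last.
- by case: w w0.
- by case: v v0.
by split=> E a; have := E a; rewrite !power_word_act.
Qed.

(** * The automaton of the wreath product *)

(** Moving to a constant function records the component chosen by the first
    letter: from then on the T-coordinates read have no influence on the
    action on B-coordinates, yet the state keeps the shape (f, t). *)
Definition wreath_transition (A : automaton) (T : finMonoidType)
    (p : ({ffun T -> state A} * T) * (T * alphabet A)) :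
    ({ffun T -> state A} * T) * (T * alphabet A) :=
  let: (f, t, (x, b)) := p in
  let: (q, b') := transition (f x, b) in
  ([ffun=> q], t, (x * t, b')).

Definition wreath_automaton (A : automaton) (T : finMonoidType) : automaton :=
  Automaton (@wreath_transition A T).

Definition wreath_gen (S : monoidType) (T : finMonoidType) (A : automaton)
    (g : state A -> S) (p : state (wreath_automaton A T)) : wreath S T :=
  ([ffun x => g (p.1 x)], p.2).

(** The states of A that act in turn on the B-coordinates, when the first letter
    has T-coordinate x; each (f, t) in the word translates this coordinate by t
    before the next state reads it. *)
Fixpoint coord_word (A : automaton) (T : finMonoidType) (x : T)
    (w : seq (state (wreath_automaton A T))) : seq (state A) :=
  if w is (f, t) :: w' then f x :: coord_word (x * t) w' else [::].

Definition shift (A : automaton) (T : finMonoidType)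
    (w : seq (state (wreath_automaton A T))) : T :=
  word_val snd w.

(** The recursion of [coord_word] is that of the wreath multiplication: the
    x-component of (s, t) (s', t') is s x * s' (x * t). *)
Lemma word_val_wreath (S : monoidType) (T : finMonoidType) (A : automaton)
    (g : state A -> S) (w : seq (state (wreath_automaton A T))) :
  word_val (wreath_gen g) w
  = ([ffun x => word_val g (coord_word x w)], shift w).
Proof.
elim: w => [|[f t] w IHw].
  rewrite /shift /word_val big_nil; congr pair; last by rewrite big_nil.
  by apply/ffunP=> x; rewrite !ffunE big_nil.
rewrite word_val_cons IHw [in RHS]/shift word_val_cons; congr pair.
by apply/ffunP=> x; rewrite !ffunE word_val_cons.
Qed.

(** The default value 1 of [head] is harmless: it is taken only when the word of
    B-coordinates is empty, which every state fixes. *)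
Lemma wreath_state_act (A : automaton) (T : finMonoidType)
    (f : {ffun T -> state A}) (t : T) (a : seq (T * alphabet A)) :
  let a' := state_act (A := wreath_automaton A T) (f, t) a in
  unzip1 a' = [seq x * t | x <- unzip1 a]
  /\ unzip2 a' = state_act (f (head 1 (unzip1 a))) (unzip2 a).
Proof.
elim: a f => [//|[x b] a IHa] f /=; case: (transition _) => q b' /=.
by have [-> ->] := IHa [ffun=> q]; rewrite ffunE.
Qed.

Lemma wreath_word_act (A : automaton) (T : finMonoidType)
    (w : seq (state (wreath_automaton A T))) (a : seq (T * alphabet A)) :
  let a' := word_act w a in
  unzip1 a' = [seq x * shift w | x <- unzip1 a]
  /\ unzip2 a' = word_act (coord_word (head 1 (unzip1 a)) w) (unzip2 a).
Proof.
elim: w a => [|[f t] w IHw] a /=.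
  by rewrite /shift /word_val big_nil; split=> //; rewrite (eq_map (@mulg1 _)) map_id.
have [-> ->] := IHw (state_act (A := wreath_automaton A T) (f, t) a).
have [-> ->] := wreath_state_act f t a; split.
  rewrite -map_comp; apply: eq_map => x /=.
  by rewrite /shift word_val_cons mulgA.
case: a => [|[x b] a] //=.
by rewrite !word_act_nil.
Qed.

(** The T-part of the value is read off from the one-letter word (1, b0), which
    is where a letter of B is needed; the x-component is read off from the words
    all of whose T-coordinates equal x. *)
Lemma wreath_realizes_faithful (S : monoidType) (T : finMonoidType)
    (A : automaton) (g : state A -> S) (b0 : alphabet A)
    (v w : seq (state (wreath_automaton A T))) :
  realizes g -> v != [::] -> w != [::] ->
  word_act v =1 word_act w <->
  word_val (wreath_gen g) v = word_val (wreath_gen g) w.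
Proof.
move=> [_ faith] v0 w0; rewrite !word_val_wreath.
have coord0 x u : u != [::] -> coord_word (A := A) (T := T) x u != [::].
  by case: u => [|[]].
split=> [E|[/ffunP Ef Et] a].
  congr pair; last first.
    have := congr1 unzip1 (E [:: (1, b0)]).
    have [-> _] := wreath_word_act v [:: (1, b0)].
    by have [-> _] := wreath_word_act w [:: (1, b0)] => /= -[]; rewrite !mul1g.
  apply/ffunP=> x; rewrite !ffunE; apply/faith; rewrite ?coord0 // => -[|b a].
    by rewrite !word_act_nil.
  pose c := [seq (x, b') | b' <- b :: a].
  have c2 : unzip2 c = b :: a by rewrite /unzip2 -map_comp map_id.
  have := congr1 unzip2 (E c).
  have [_ ->] := wreath_word_act v c; have [_ ->] := wreath_word_act w c.
  by rewrite c2.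
rewrite -[LHS]zip_unzip -[RHS]zip_unzip.
have [-> ->] := wreath_word_act v a; have [-> ->] := wreath_word_act w a.
rewrite Et; congr zip.
by have := Ef (head 1 (unzip1 a)); rewrite !ffunE => /faith-> //; apply: coord0.
Qed.

Lemma word_val_pad (S : monoidType) (Q : Type) (g : Q -> S) (i : Q) n w :
  g i = 1 -> size w <= n -> word_val g (mkseq (nth i w) n) = word_val g w.
Proof.
move=> gi1 wn; rewrite -(subnKC wn) /mkseq iotaD map_cat word_val_cat.
rewrite -/(mkseq _ _) mkseq_nth -[RHS]mulg1; congr (_ * _).
rewrite /word_val big_map big_seq big1 // => j; rewrite mem_iota => /andP[lej _].
by rewrite nth_default.
Qed.

(** Words for the components s x, padded with the identity state i to a common
    length n, are read columnwise as states with trivial T-part.  A last state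
    (const i, t) contributes the T-part; it also makes the word non-empty. *)
Lemma wreath_generated (S : monoidType) (T : finMonoidType)
    (A : automaton) (g : state A -> S) (i : state A) :
  realizes g -> g i = 1 ->
  forall s : wreath S T, exists2 w, w != [::] & word_val (wreath_gen g) w = s.
Proof.
move=> [gen _] gi1 [s t].
have /choice[r rE] x : exists u, word_val g u = s x.
  by have [u _ <-] := gen (s x); exists u.
pose n := \max_x size (r x).
pose pad : seq (state (wreath_automaton A T)) :=
  mkseq (fun j => ([ffun x => nth i (r x) j], 1)) n.
exists (rcons pad ([ffun=> i], t)); first by case: pad.
have coord_pad x : coord_word x (rcons pad ([ffun=> i], t))
    = rcons (mkseq (nth i (r x)) n) i.
  rewrite /pad /mkseq; elim: (iota 0 n) => /= [|j js IHj].
    by rewrite ffunE.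
  by rewrite mulg1 IHj ffunE.
rewrite word_val_wreath; congr pair.
  apply/ffunP=> x; rewrite ffunE coord_pad -cats1 word_val_cat.
  rewrite word_val_pad //; last exact: (leq_bigmax x).
  by rewrite rE word_val_cons /word_val big_nil gi1 !mulg1.
rewrite /shift -cats1 word_val_cat /pad /mkseq {1}/word_val big_map big1 //.
by rewrite word_val_cons /word_val big_nil mul1g mulg1.
Qed.

Theorem theorem5 (S : monoidType) (T : finMonoidType)
    (hS : automaton_monoid S) :
  automaton_monoid (wreath S T).
Proof.
have [A [g gP]] := automaton_semigroup_realizes hS.
have [A1 [g1 [g1P [b0]]]] := realizes_nonempty_alphabet gP.
have [k [h [hP [i hi1]]]] := realizes_with_identity g1P.
apply: (@realizes_automaton_semigroup _ _ (wreath_gen (T := T) h)).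
split; first exact: wreath_generated hP hi1.
by move=> v w; apply: (@wreath_realizes_faithful _ _ (power_automaton A1 k)).
Qed.
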